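(* Let $\sigma>0$ and, for $\gamma_0>0$, define $$t_0(\gamma_0):=\frac{\gamma_0^2}{2\sigma\gamma_0-\lfloor2\sigma\gamma_0\rfloor},$$ with $t_0(\gamma_0)=+\infty$ when $2\sigma\gamma_0$ is an integer. Then the following hold. (a) A minimizer of $t_0$ cannot exist in an interval $2\sigma\gamma_0\in[n,n+1]$ where $n>1$ is an integer. (b) The infimum of $t_0$ satisfies $$f^*:=\inf_{\gamma_0}\{t_0(\gamma_0)\mid1<2\sigma\gamma_0<2\}=\frac1{\sigma^2}.$$ (c) Let an $\epsilon$-infimum of $t_0$ mean a value $f_\epsilon^*$ of $t_0$ (on $1<2\sigma\gamma_0<2$) satisfying $f_\epsilon^*\le f^*+\beta\epsilon$ for some $\beta>0$. Then, for $\epsilon\in(0,1/2)$, an $\epsilon$-infimum $f_\epsilon^*$ is achieved by $\gamma_0=\frac{2-\epsilon}{2\sigma}$, and it satisfies $f_\epsilon^*\le f^*+\frac{2\epsilon}{\sigma^2}$.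
   Context: ''Minimizer'' in (a) means a global minimizer of $t_0$ over positive $\gamma_0$. In the paper $\sigma$ is a strong pseudomonotonicity constant and $\gamma_0$ an initial steplength, but only $\sigma>0$ and $\gamma_0>0$ matter here. *)

(* Defs.v *)
From HB Require Import structures.
From mathcomp Require Import all_boot all_order all_algebra.
From mathcomp Require Import all_classical all_reals all_analysis.

Set Implicit Arguments.
Unset Strict Implicit.
Unset Printing Implicit Defensive.

Import Order.TTheory GRing.Theory Num.Theory.

Local Open Scope classical_set_scope.
Local Open Scope ring_scope.

Definition t0 (R : realType) (sigma gamma : R) : \bar R :=
  if 2 * sigma * gamma \is a Num.int then +oo%E
  else (gamma ^+ 2 /
        (2 * sigma * gamma - (Num.floor (2 * sigma * gamma))%:~R))%:E.

Definition t0_minimizer (R : realType) (sigma gamma : R) : Prop :=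
  0 < gamma /\
  forall gamma' : R, 0 < gamma' -> (t0 sigma gamma <= t0 sigma gamma')%E.

Definition steps12 (R : realType) (sigma : R) : set R :=
  [set gamma | 1 < 2 * sigma * gamma < 2].

Definition fstar (R : realType) (sigma : R) : \bar R :=
  ereal_inf [set t0 sigma gamma | gamma in steps12 sigma].

(* The factor [beta] is a parameter so that it can be quantified before [eps]:
   were it allowed to depend on [eps], every finite value of [t0] would
   qualify. *)
Definition eps_infimum (R : realType) (sigma beta eps : R) (f : \bar R) : Prop :=
  [/\ 0 < beta,
      [set t0 sigma gamma | gamma in steps12 sigma] f
    & (f <= fstar sigma + (beta * eps)%:E)%E].

(* Main.v *)
Require Import Defs.
From HB Require Import structures.
From mathcomp Require Import all_boot all_order all_algebra.
From mathcomp Require Import all_classical all_reals all_analysis.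
From mathcomp Require Import ring lra.

Set Implicit Arguments.
Unset Strict Implicit.
Unset Printing Implicit Defensive.

Import Order.TTheory GRing.Theory Num.Theory.

Local Open Scope classical_set_scope.
Local Open Scope ring_scope.

(** Write [x = 2 * sigma * gamma], so that
    [t0 = x ^ 2 / (4 * sigma ^ 2 * (x - floor x))] off the integers.

    Decreasing [x] by one keeps the denominator and shrinks the numerator, so
    no point with [x > 1] minimizes [t0] ([t0_not_minimizer]); where [x] is an
    integer, [t0] is infinite and any non-integer point does better.

    On [1 < x < 2] the value is [x ^ 2 / (4 * sigma ^ 2 * (x - 1))], which is at
    least [1 / sigma ^ 2] because [x ^ 2 - 4 * (x - 1) = (x - 2) ^ 2]
    ([t0_steps12_ge]). At [x = 2 - eps] it exceeds [1 / sigma ^ 2] by exactly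
    [eps ^ 2 / (4 * sigma ^ 2 * (1 - eps))], hence by at most
    [2 * eps / sigma ^ 2] when [eps < 1 / 2] ([t0_near2_le]). Letting [eps] tend
    to zero gives the infimum, and the same bound shows that
    [beta = 2 / sigma ^ 2] works for every [eps]. *)

Lemma t0_between (R : realType) (sigma gamma : R) (n : int) :
  n%:~R < 2 * sigma * gamma < (n + 1)%:~R ->
  t0 sigma gamma = (gamma ^+ 2 / (2 * sigma * gamma - n%:~R))%:E.
Proof.
move=> /andP[nx xn].
have fx : Num.floor (2 * sigma * gamma) = n.
  by apply: floor_def; rewrite (ltW nx) xn.
by rewrite /t0 intrEfloor fx (lt_eqF nx).
Qed.

Lemma t0_steps12 (R : realType) (sigma gamma : R) :
  steps12 sigma gamma ->
  t0 sigma gamma = (gamma ^+ 2 / (2 * sigma * gamma - 1))%:E.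
Proof. exact: (@t0_between R sigma gamma 1). Qed.

Lemma t0_not_minimizer (R : realType) (sigma gamma : R) :
  0 < sigma -> 1 < 2 * sigma * gamma -> ~ t0_minimizer sigma gamma.
Proof.
move=> s0 x1 [g0 gmin].
have s20 : 0 < 2 * sigma by rewrite mulr_gt0.
have s2n0 : 2 * sigma != 0 by rewrite gt_eqF.
have [xint|xnint] := boolP (2 * sigma * gamma \is a Num.int).
  (* Compare with the finite value at [2 * sigma * gamma' = 1 / 2]. *)
  have h0 : 0 < (1 / 2) / (2 * sigma) :> R by rewrite divr_gt0.
  have := gmin _ h0.
  rewrite (@t0_between _ _ (1 / 2 / (2 * sigma)) 0); last first.
    by rewrite mulrC divfK// add0r; lra.
  by rewrite /t0 xint leye_eq.
pose n := Num.floor (2 * sigma * gamma).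
have nx : n%:~R < 2 * sigma * gamma.
  by rewrite lt_neqAle -intrEfloor xnint floor_le.
have xn : 2 * sigma * gamma < (n + 1)%:~R by exact: floorD1_gt.
(* [2 * sigma * h] has the fractional part of [2 * sigma * gamma] and integer
   part [n - 1]; [1 < 2 * sigma * gamma] is what makes [h] positive. *)
pose h := gamma - 1 / (2 * sigma).
have hx : 2 * sigma * h = 2 * sigma * gamma - 1.
  by rewrite /h mulrBr [X in _ - X]mulrC divfK.
have h0 : 0 < h by rewrite -(pmulr_rgt0 _ s20) hx subr_gt0.
have hg : h < gamma by rewrite /h ltrBlDr ltrDl divr_gt0.
have := gmin _ h0.
rewrite (@t0_between _ _ gamma n) ?nx//.
rewrite (@t0_between _ _ h (n - 1)); last first.
  by rewrite hx; move: nx xn; rewrite !intrD intrN; lra.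
have -> : 2 * sigma * h - (n - 1)%:~R = 2 * sigma * gamma - n%:~R.
  by rewrite hx intrD intrN; ring.
rewrite lee_fin ler_pM2r; last by rewrite invr_gt0 subr_gt0.
by rewrite leNgt ltrXn2r// ltW.
Qed.

Lemma t0_steps12_ge (R : realType) (sigma gamma : R) :
  0 < sigma -> steps12 sigma gamma ->
  ((1 / sigma ^+ 2)%:E <= t0 sigma gamma)%E.
Proof.
move=> s0 sg; rewrite (t0_steps12 sg) lee_fin.
have /andP[x1 _] : 1 < 2 * sigma * gamma < 2 := sg.
rewrite ler_pdivrMr ?exprn_gt0// mulrAC ler_pdivlMr ?subr_gt0// mul1r.
rewrite -subr_ge0.
have -> : gamma ^+ 2 * sigma ^+ 2 - (2 * sigma * gamma - 1) =
  (sigma * gamma - 1) ^+ 2 by ring.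
exact: sqr_ge0.
Qed.

Lemma steps12_near2 (R : realType) (sigma eps : R) :
  0 < sigma -> 0 < eps < 1 -> steps12 sigma ((2 - eps) / (2 * sigma)).
Proof.
move=> s0 /andP[e0 e1]; rewrite /steps12 /= mulrC divfK; first by lra.
by rewrite gt_eqF// mulr_gt0.
Qed.

Lemma t0_near2_le (R : realType) (sigma eps : R) :
  0 < sigma -> 0 < eps < 1 / 2 ->
  (t0 sigma ((2 - eps) / (2 * sigma)) <=
   (1 / sigma ^+ 2 + 2 * eps / sigma ^+ 2)%:E)%E.
Proof.
move=> s0 /andP[e0 e2].
have sn0 : sigma != 0 by rewrite gt_eqF.
rewrite t0_steps12; last by apply: steps12_near2 => //; lra.
have -> : 2 * sigma * ((2 - eps) / (2 * sigma)) - 1 = 1 - eps.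
  by field.
have e10 : 0 < 1 - eps by lra.
rewrite lee_fin ler_pdivrMr//.
have -> : ((2 - eps) / (2 * sigma)) ^+ 2 = (2 - eps) ^+ 2 / 4 / sigma ^+ 2.
  by field.
rewrite -mulrDl [leRHS]mulrAC ler_pM2r ?invr_gt0 ?exprn_gt0//.
by nra.
Qed.

Lemma fstarE (R : realType) (sigma : R) :
  0 < sigma -> fstar sigma = (1 / sigma ^+ 2)%:E.
Proof.
move=> s0; apply/le_anti/andP; split; last first.
  by apply/ereal_infP => _ [gamma sg <-]; exact: t0_steps12_ge.
apply/lee_addgt0Pr => d d0.
have s20 : 0 < sigma ^+ 2 by rewrite exprn_gt0.
(* The excess [2 * eps / sigma ^ 2] must not be larger than [d]. *)
pose eps := Num.min (1 / 4) (d * sigma ^+ 2 / 2).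
have e0 : 0 < eps by rewrite lt_min !divr_gt0 ?mulr_gt0.
have e4 : eps <= 1 / 4 by rewrite ge_min lexx.
have ed : eps <= d * sigma ^+ 2 / 2 by rewrite ge_min lexx orbT.
have e2 : 0 < eps < 1 / 2 by lra.
apply: (@le_trans _ _ (t0 sigma ((2 - eps) / (2 * sigma)))).
  apply: ereal_inf_lbound; exists ((2 - eps) / (2 * sigma)) => //.
  by apply: steps12_near2 => //; lra.
apply: le_trans (t0_near2_le s0 e2) _.
by rewrite -EFinD lee_fin lerD2l ler_pdivrMr//; lra.
Qed.

Theorem lemma7 (R : realType) (sigma : R) (sigma_gt0 : 0 < sigma) :
  [/\ (forall (n : int) (gamma : R), 1 < n ->
         n%:~R <= 2 * sigma * gamma <= (n + 1)%:~R ->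
         ~ t0_minimizer sigma gamma),
      fstar sigma = (1 / sigma ^+ 2)%:E
    & exists beta : R, forall eps : R, 0 < eps < 1 / 2 ->
        let gamma := (2 - eps) / (2 * sigma) in
        [/\ steps12 sigma gamma,
            eps_infimum sigma beta eps (t0 sigma gamma)
          & (t0 sigma gamma <= fstar sigma + (2 * eps / sigma ^+ 2)%:E)%E]].
Proof.
split.
- move=> n gamma n1 /andP[nx _]; apply: t0_not_minimizer => //.
  by apply: lt_le_trans nx; rewrite ltr1z.
- exact: fstarE.
exists (2 / sigma ^+ 2) => eps e2 gamma.
have sg : steps12 sigma gamma by apply: steps12_near2 => //; lra.
have tle : (t0 sigma gamma <= fstar sigma + (2 * eps / sigma ^+ 2)%:E)%E.
  by rewrite fstarE// -EFinD; exact: t0_near2_le.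
split=> //; split; first by rewrite divr_gt0 ?exprn_gt0.
- by exists gamma.
- by rewrite mulrAC.
Qed.
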